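(* Let $(X,A)$ be a relative gathered CW complex. Let $f\colon X\to Y$ be a smooth map to a diffeological space $Y$ and let $h\colon A\times I\to Y$ be a tame homotopy satisfying $h(a,0)=f(a)$ for all $a\in A$. Then there exists a tame homotopy $H\colon X\times I\to Y$ satisfying $H|_{A\times I}=h$ and $H(x,0)=f(x)$ for all $x\in X$.
   Context: All spaces are diffeological spaces; $I=[0,1]$; $I^n$ and $\partial I^n$ carry the subspace diffeology of $\mathbf{R}^n$; products, coproducts, pushouts and colimits are in the category of diffeological spaces. Tame maps: for a cubical subcomplex $K$ of $I^n$, a smooth map $f\colon K\to X$ is $\epsilon$-tame ($0<\epsilon\le1/2$) if for every $j$, every $\alpha\in\{0,1\}$ and every $(t_1,\dots,t_n)\in K$ with $|t_j-\alpha|\le\epsilon$ one has $f(t_1,\dots,t_j,\dots,t_n)=f(t_1,\dots,\alpha,\dots,t_n)$ ($\alpha$ in the $j$-th place). A homotopy (smooth map) $F\colon X\times I\to Y$ is $\epsilon$-tame if $F(x,t)=F(x,\alpha)$ for all $x\in X$ and all $t\in I$ with $|t-\alpha|\le\epsilon$, $\alpha\in\{0,1\}$. ''Tame'' means $\epsilon$-tame for some $\epsilon>0$. Smooth relative CW complex: a pair $(X,A)$ of diffeological spaces with a sequence of inclusions (skeleta) $A=X^{-1}\to X^0\to X^1\to\cdots$ such that the natural map $X^{-1}\to\mathrm{colim}\,X^n$ coincides with the inclusion $A\to X$, and for each $n\ge0$ the space $X^n$ is the pushout of $X^{n-1}\xleftarrow{\bigcup\phi_\lambda}\coprod_{\lambda\in\Lambda_n}\partial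 I^n\hookrightarrow\coprod_{\lambda\in\Lambda_n}I^n$; the $\phi_\lambda\colon\partial I^n\to X^{n-1}$ are the attaching maps. It is gathered if all attaching maps are tame. *)

(* Defs.v *)
From mathcomp Require Import all_boot all_order all_algebra.
From mathcomp Require Import all_classical all_reals all_analysis.

Set Implicit Arguments.
Unset Strict Implicit.
Unset Printing Implicit Defensive.

Import Order.TTheory GRing.Theory Num.Theory.
Import numFieldNormedType.Exports.
Local Open Scope classical_set_scope.
Local Open Scope ring_scope.

Section Smoothness.
Context {R : realType}.

(* Functions are total, but only their values on the open set U matter
   (see [smooth_fun_ext]). *)
Fixpoint Ck (k : nat) n (U : set 'rV[R]_n) (f : 'rV[R]_n -> R) : Prop :=
  if k is k'.+1 then
    (forall x, U x -> differentiable f x) /\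
    (forall i : 'I_n, Ck k' U ('D_('e_i) f))
  else forall x, U x -> {for x, continuous f}.

Definition smooth_fun n (U : set 'rV[R]_n) (f : 'rV[R]_n -> R) :=
  forall k, Ck k U f.

Definition smooth_vec n m (U : set 'rV[R]_n) (f : 'rV[R]_n -> 'rV[R]_m) :=
  forall j : 'I_m, smooth_fun U (fun x => f x 0 j).

Lemma near0_differentiable n (k : 'rV[R]_n -> R) x :
  (\forall y \near x, k y = 0) -> differentiable k x.
Proof.
move=> k0.
have littleo : k \o shift x = cst (k x) + (\0 : 'rV[R]_n -> R) +o_ 0 id.
  apply/eqaddoP => _/posnumP[e]; near=> h.
  suff E : k (h + x) = 0.
    rewrite [X in `|X|](_ : _ = k (h + x) - (k x + 0)) //.
    by rewrite E (nbhs_singleton k0) addr0 subrr normr0 mulr_ge0.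
  by rewrite addrC; near: h; exact: ((nbhs0P (fun y => k y = 0) x).1 k0).
have c0 : continuous (\0 : 'rV[R]_n -> R) by exact: (@cst_continuous _ _ 0).
have d0 : 'd k x = \0 :> ('rV[R]_n -> R).
  exact: (@diff_unique R _ _ k (\0 : {linear 'rV[R]_n -> R}) x c0 littleo).
by apply/diff_locallyP; rewrite d0.
Unshelve. all: by end_near. Qed.

Lemma near_eq_differentiable n (f g : 'rV[R]_n -> R) x :
  (\forall y \near x, f y = g y) -> differentiable f x -> differentiable g x.
Proof.
move=> fg df; have -> : g = f + (g - f) by rewrite addrC subrK.
apply: differentiableD => //; apply: near0_differentiable.
near=> y; rewrite [LHS](_ : _ = g y - f y) //; apply/eqP.
by rewrite subr_eq0 eq_sym; apply/eqP; near: y.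
Unshelve. all: by end_near. Qed.

Lemma Ck_sub k n (U V : set 'rV[R]_n) f : V `<=` U -> Ck k U f -> Ck k V f.
Proof.
move=> VU; elim: k f => [|k IH] f /= H; first by move=> x /VU; exact: H.
by case: H => H1 H2; split=> [x /VU|i]; [exact: H1|exact/IH/H2].
Qed.

Lemma Ck_ext k n (U : set 'rV[R]_n) f g : open U ->
  (forall x, U x -> f x = g x) -> Ck k U f -> Ck k U g.
Proof.
move=> oU; elim: k f g => [|k IH] f g fg /= H.
  have nfg x : U x -> \forall y \near x, f y = g y.
    move=> Ux; have := open_nbhs_nbhs (conj oU Ux).
    by apply: filterS => y; exact: fg.
  move=> x Ux; rewrite /prop_for /continuous_at -fg //.
  apply: cvg_trans (near_eq_cvg (nfg x Ux)) _; exact: H.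
have nfg x : U x -> \forall y \near x, f y = g y.
  move=> Ux; have := open_nbhs_nbhs (conj oU Ux).
  by apply: filterS => y; exact: fg.
case: H => H1 H2; split=> [x Ux|i].
  exact: near_eq_differentiable (nfg x Ux) (H1 x Ux).
by apply: IH (H2 i) => x Ux; apply: near_eq_derive; exact: nfg.
Qed.

Lemma Ck_local k n (U : set 'rV[R]_n) f :
  (forall x, U x -> exists V, V x /\ Ck k V f) -> Ck k U f.
Proof.
elim: k f => [|k IH] f /= H.
  by move=> x /H[V [Vx]]; apply.
split=> [x /H[V [Vx [HV _]]]|i]; first exact: HV.
by apply: IH => x /H[V [Vx [_ HV]]]; exists V.
Qed.

Lemma Ck_le k n (U : set 'rV[R]_n) f : Ck k.+1 U f -> Ck k U f.
Proof.
elim: k f => [|k IH] f /= [H1 H2].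
  by move=> x Ux; apply: differentiable_continuous; exact: H1.
by split => // i; apply: IH; exact: H2.
Qed.

Lemma Ck_cst k n (U : set 'rV[R]_n) (c : R) : Ck k U (cst c).
Proof.
elim: k c => [|k IH] c /=; first by move=> x _; exact: (@cst_continuous _ _ c).
split=> [x _|i]; first exact: differentiable_cst.
rewrite (_ : 'D_ _ _ = cst 0) //; apply/funext => x; exact: derive_cst.
Qed.

Lemma Ck_add k n (U : set 'rV[R]_n) f g : open U ->
  Ck k U f -> Ck k U g -> Ck k U (f \+ g).
Proof.
move=> oU; elim: k f g => [|k IH] f g /= Hf Hg.
  by move=> x Ux; exact: (continuousD (Hf x Ux) (Hg x Ux)).
case: Hf Hg => [f1 f2] [g1 g2]; split=> [x Ux|i].
  by apply: differentiableD; [exact: f1|exact: g1].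
apply: Ck_ext (IH _ _ (f2 i) (g2 i)) => // x Ux /=.
by rewrite deriveD //; apply: diff_derivable; [exact: f1|exact: g1].
Qed.

Lemma Ck_mul k n (U : set 'rV[R]_n) f g : open U ->
  Ck k U f -> Ck k U g -> Ck k U (f \* g).
Proof.
move=> oU; elim: k f g => [|k IH] f g Hf Hg.
  by move=> x Ux; exact: (continuousM (Hf x Ux) (Hg x Ux)).
have f0 := Ck_le Hf; have g0 := Ck_le Hg.
case: Hf Hg => [f1 f2] [g1 g2]; split=> [x Ux|i].
  by apply: differentiableM; [exact: f1|exact: g1].
apply: Ck_ext (Ck_add oU (IH _ _ f0 (g2 i)) (IH _ _ g0 (f2 i))) => // x Ux /=.
by rewrite deriveM //; apply: diff_derivable; [exact: f1|exact: g1].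
Qed.

Lemma Ck_sum k n (U : set 'rV[R]_n) m (F : 'I_m -> 'rV[R]_n -> R) : open U ->
  (forall j, Ck k U (F j)) -> Ck k U (fun x => \sum_j F j x).
Proof.
move=> oU HF; suff H s : Ck k U (fun x => \sum_(j <- s) F j x) by exact: H.
elim: s => [|j s IH].
  rewrite (_ : (fun _ => _) = cst 0); first exact: Ck_cst.
  by apply/funext=> x; rewrite big_nil.
rewrite (_ : (fun _ => _) = F j \+ fun x => \sum_(j <- s) F j x).
  exact: Ck_add.
by apply/funext => x /=; rewrite big_cons.
Qed.

Lemma continuous_vec n m (g : 'rV[R]_n -> 'rV[R]_m) x :
  (forall j, {for x, continuous (fun y => g y 0 j)}) -> {for x, continuous g}.
Proof.
move=> H; rewrite (_ : g = \sum_j (fun y => g y 0 j *: delta_mx 0 j)).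
  elim/big_ind : _ => [|u v|j _]; first exact: (@cst_continuous _ _ (0 : 'rV[R]_m) x).
    exact: continuousD.
  exact/continuousZr_tmp/H.
apply/funext => y; rewrite {1}[g y]row_sum_delta; elim/big_rec2 : _ => //.
by move=> i a b _ ->.
Qed.

Lemma differentiable_vec n m (g : 'rV[R]_n -> 'rV[R]_m) x :
  (forall j, differentiable (fun y => g y 0 j) x) -> differentiable g x.
Proof.
move=> H; rewrite (_ : g = \sum_j (fun y => g y 0 j *: delta_mx 0 j)).
  by apply: differentiable_sum => j; exact: differentiableZl.
apply/funext => y; rewrite {1}[g y]row_sum_delta; elim/big_rec2 : _ => //.
by move=> i a b _ ->.
Qed.

Lemma derive_coord n m (g : 'rV[R]_n -> 'rV[R]_m) x v j :
  differentiable g x -> 'D_v (fun y => g y 0 j) x = ('d g x v : 'rV[R]_m) 0 j.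
Proof.
move=> dg; have dc := @differentiable_coord R 1 m (g x) 0 j.
have @c : {linear 'rV[R]_m -> R}.
  by exists (fun N : 'rV[R]_m => N 0 j); do 2![eexists]; do ?[constructor];
     rewrite ?mxE// => ? *; rewrite ?mxE//; move=> ?; rewrite !mxE.
have cc : continuous c by exact: coord_continuous.
have dc' : differentiable c (g x) by exact: linear_differentiable.
have -> : (fun y => g y 0 j) = c \o g by [].
rewrite deriveE; last exact: differentiable_comp.
by rewrite diff_comp //= (diff_lin _ cc).
Qed.

Lemma chain_rule n m (g : 'rV[R]_n -> 'rV[R]_m) (f : 'rV[R]_m -> R) x v :
  (forall j, differentiable (fun y => g y 0 j) x) -> differentiable f (g x) ->
  'D_v (f \o g) x =
  \sum_j 'D_v (fun y => g y 0 j) x * 'D_('e_j) f (g x).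
Proof.
move=> dgj df; have dg := differentiable_vec dgj.
rewrite deriveE; last exact: differentiable_comp.
rewrite diff_comp //= [X in 'd f _ X](row_sum_delta ('d g x v)) linear_sum /=.
apply: eq_bigr => j _; rewrite linearZ /= (derive_coord _ _ dg).
by congr (_ * _); rewrite deriveE.
Qed.

Lemma Ck_comp k n m (U : set 'rV[R]_n) (V : set 'rV[R]_m) g f :
  open U -> (forall x, U x -> V (g x)) ->
  (forall j, Ck k U (fun x => g x 0 j)) -> Ck k V f -> Ck k U (f \o g).
Proof.
move=> oU UV; elim: k f => [|k IH] f Hg Hf.
  move=> x Ux; apply: continuous_comp; last exact/Hf/UV.
  by apply: continuous_vec => j; exact: Hg.
have g0 j := Ck_le (Hg j).
have dg x (Ux : U x) j : differentiable (fun y => g y 0 j) x.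
  by case: (Hg j) => + _; exact.
case: Hf => f1 f2; split=> [x Ux|i].
  by apply: differentiable_comp; [exact/differentiable_vec/dg|exact/f1/UV].
pose F j := (fun x => 'D_('e_i) (fun y => g y 0 j) x)
            \* ('D_('e_j) f \o g).
have H j : Ck k U (F j).
  apply: Ck_mul => //; first by case: (Hg j) => _ ; exact.
  by apply: IH => //; exact: f2.
apply: Ck_ext (Ck_sum oU H) => // x Ux.
by rewrite chain_rule //; [exact: dg|exact/f1/UV].
Qed.

Lemma smooth_fun_ext n (U : set 'rV[R]_n) f g : open U ->
  (forall x, U x -> f x = g x) -> smooth_fun U f -> smooth_fun U g.
Proof. by move=> oU fg Hf k; exact: Ck_ext (Hf k). Qed.

Lemma smooth_fun_local n (U : set 'rV[R]_n) f :
  (forall x, U x -> exists V, V x /\ smooth_fun V f) -> smooth_fun U f.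
Proof. by move=> H k; apply: Ck_local => x /H[V [Vx HV]]; exists V. Qed.

Lemma smooth_fun_comp n m (U : set 'rV[R]_n) (V : set 'rV[R]_m) g f :
  open U -> (forall x, U x -> V (g x)) ->
  smooth_vec U g -> smooth_fun V f -> smooth_fun U (f \o g).
Proof.
by move=> oU UV Hg Hf k; apply: Ck_comp (Hf k) => // j; exact: Hg.
Qed.

End Smoothness.

(* [plot U p] means that U is open and that the restriction of p to U is a
   plot.  Parametrizations U -> X are encoded by total functions, of which only
   the values on U are relevant, by [plot_ext].  When X is empty there is no
   such function, but the only parametrization U -> X is then the empty one. *)
Record diffSpace (R : realType) := DiffSpace {
  carrier :> Type;
  plot : forall n, set 'rV[R]_n -> ('rV[R]_n -> carrier) -> Prop;
  plot_open : forall n (U : set 'rV[R]_n) p, plot U p -> open U;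
  plot_ext : forall n (U : set 'rV[R]_n) p q,
    (forall x, U x -> p x = q x) -> plot U p -> plot U q;
  plot_cst : forall n (U : set 'rV[R]_n) c, open U -> plot U (fun=> c);
  plot_local : forall n (U : set 'rV[R]_n) p, open U ->
    (forall x, U x -> exists V, [/\ V x, V `<=` U & plot V p]) -> plot U p;
  plot_comp : forall n m (U : set 'rV[R]_n) (V : set 'rV[R]_m) p g,
    plot U p -> open V -> smooth_vec V g -> (forall y, V y -> U (g y)) ->
    plot V (p \o g)
}.

Arguments plot {R} d {n} U p.

Section Diffeology.
Context {R : realType}.
Implicit Types X Y Z : diffSpace R.

#[local] Obligation Tactic := idtac.

Definition smooth X Y (f : X -> Y) :=
  forall n (U : set 'rV[R]_n) (p : 'rV[R]_n -> X), plot X U p -> plot Y U (f \o p).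

Program Definition euclidean m : diffSpace R := {|
  carrier := 'rV[R]_m;
  plot := fun n U p => open U /\ smooth_vec U p
|}.
Next Obligation.
by move=> m n U p [].
Qed.
Next Obligation.
move=> m n U p q pq [oU Hp]; split=> // j.
by apply: smooth_fun_ext (Hp j) => // x Ux; rewrite pq.
Qed.
Next Obligation.
by move=> m n U c oU; split=> // j k; exact: Ck_cst.
Qed.
Next Obligation.
move=> m n U p oU Hp; split=> // j; apply: smooth_fun_local => x Ux.
by have [V [Vx _ [_ HV]]] := Hp x Ux; exists V; split.
Qed.
Next Obligation.
move=> m n r U V p g [oU Hp] oV Hg VU; split=> // j.
exact: (@smooth_fun_comp R _ _ V U g (fun x => p x 0 j)).
Qed.

Program Definition line : diffSpace R := {|
  carrier := R;
  plot := fun n U p => open U /\ smooth_fun U p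
|}.
Next Obligation.
by move=> n U p [].
Qed.
Next Obligation.
by move=> n U p q pq [oU Hp]; split=> //; exact: smooth_fun_ext Hp.
Qed.
Next Obligation.
by move=> n U c oU; split=> // k; exact: Ck_cst.
Qed.
Next Obligation.
move=> n U p oU Hp; split=> //; apply: smooth_fun_local => x Ux.
by have [V [Vx _ [_ HV]]] := Hp x Ux; exists V; split.
Qed.
Next Obligation.
move=> n m U V p g [oU Hp] oV Hg VU; split=> //.
exact: (@smooth_fun_comp R _ _ V U g p).
Qed.

Program Definition sub_space X (A : set X) : diffSpace R := {|
  carrier := set_type A;
  plot := fun n U p => plot X U (fun x => val (p x))
|}.
Next Obligation.
by move=> X A n U p; exact: plot_open.
Qed.
Next Obligation.
move=> X A n U p q pq; apply: plot_ext => x Ux.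
by rewrite pq.
Qed.
Next Obligation.
by move=> X A n U c; exact: plot_cst.
Qed.
Next Obligation.
by move=> X A n U p; exact: plot_local.
Qed.
Next Obligation.
by move=> X A n m U V p g; exact: plot_comp.
Qed.

Definition sub_val X (A : set X) (a : sub_space A) : X := val a.

Definition sub_incl X (A B : set X) (AB : A `<=` B)
    (a : sub_space A) : sub_space B :=
  exist _ (val a) (mem_set (AB _ (set_mem (valP a)))).

Program Definition prod_space X Y : diffSpace R := {|
  carrier := (X * Y)%type;
  plot := fun n U p =>
    plot X U (fun x => (p x).1) /\ plot Y U (fun x => (p x).2)
|}.
Next Obligation.
by move=> X Y n U p [/plot_open].
Qed.
Next Obligation.
move=> X Y n U p q pq [Hp1 Hp2].
by split; [apply: plot_ext Hp1|apply: plot_ext Hp2] => x Ux; rewrite pq.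
Qed.
Next Obligation.
by move=> X Y n U c oU; split; exact: plot_cst.
Qed.
Next Obligation.
move=> X Y n U p oU Hp.
by split; apply: plot_local => // x /Hp[V [Vx VU [H1 H2]]]; exists V.
Qed.
Next Obligation.
move=> X Y n m U V p g [Hp1 Hp2] oV Hg VU.
by split; [exact: (plot_comp Hp1)|exact: (plot_comp Hp2)].
Qed.

Program Definition coprod_space (L : Type) (E : L -> diffSpace R) :
    diffSpace R := {|
  carrier := {l : L & E l};
  plot := fun n U p => open U /\ forall x, U x ->
    exists (V : set 'rV[R]_n) (l : L) (q : 'rV[R]_n -> E l),
      [/\ V x, V `<=` U, plot (E l) V q &
          forall y, V y -> p y = existT _ l (q y)]
|}.
Next Obligation.
by move=> L E n U p [].
Qed.
Next Obligation.
move=> L E n U p q pq [oU Hp]; split=> // x /Hp[V [l [r [Vx VU Hr pr]]]].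
by exists V, l, r; split=> // y Vy; rewrite -pr //; apply/esym/pq/VU.
Qed.
Next Obligation.
move=> L E n U [l e] oU; split=> // x Ux.
by exists U, l, (fun=> e); split=> //; exact: plot_cst.
Qed.
Next Obligation.
move=> L E n U p oU Hp; split=> // x.
move=> /Hp[V [Vx VU [_ /(_ x Vx)[W [l [q [Wx WV Hq pq]]]]]]].
by exists W, l, q; split=> //; exact: subset_trans VU.
Qed.
Next Obligation.
move=> L E n m U V p g [oU Hp] oV Hg VU; split=> // y Vy.
have [W [l [q [Wy WU Hq pq]]]] := Hp _ (VU _ Vy).
have oW := plot_open Hq.
have cg x : V x -> {for x, continuous g}.
  by move=> Vx; apply: continuous_vec => j; exact: (Hg j 0%N).
have oVW : open (V `&` g @^-1` W).
  rewrite openE => x [Vx Wgx]; apply: filterI; first exact: open_nbhs_nbhs.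
  by apply: cg => //; exact: open_nbhs_nbhs.
exists (V `&` g @^-1` W), l, (q \o g); split=> //.
- apply: (plot_comp Hq) => // [j k|x [_ ?] //].
  by apply: Ck_sub (Hg j k) => x [].
- by move=> x [_ Wx] /=; rewrite pq.
Qed.

Definition coprod_rec (L : Type) (E : L -> diffSpace R) X
    (f : forall l, E l -> X) (x : coprod_space E) : X :=
  f (projT1 x) (projT2 x).

Definition coprod_map (L : Type) (E F : L -> diffSpace R)
    (f : forall l, E l -> F l) (x : coprod_space E) : coprod_space F :=
  existT _ (projT1 x) (f (projT1 x) (projT2 x)).

(* An inclusion of a subspace, up to isomorphism of its source (an
   "induction" in the diffeological literature). *)
Definition inclusion X Y (f : X -> Y) :=
  injective f /\
  forall n (U : set 'rV[R]_n) (p : 'rV[R]_n -> X),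
    plot X U p <-> plot Y U (f \o p).

(* The square
       S --g--> B
       |f       |v
       A --u--> P    is a pushout of diffeological spaces. *)
Definition is_pushout (S A B P : diffSpace R)
    (f : S -> A) (g : S -> B) (u : A -> P) (v : B -> P) :=
  [/\ smooth u, smooth v, u \o f =1 v \o g &
   forall Z (a : A -> Z) (b : B -> Z), smooth a -> smooth b ->
     a \o f =1 b \o g ->
     exists! w : P -> Z, [/\ smooth w, w \o u =1 a & w \o v =1 b]].

(* X, with the maps c n : D n -> X, is the colimit of D 0 -> D 1 -> ... *)
Definition is_seq_colim (D : nat -> diffSpace R)
    (d : forall n, D n -> D n.+1) X (c : forall n, D n -> X) :=
  [/\ forall n, smooth (c n), forall n, c n.+1 \o d n =1 c n &
   forall Z (a : forall n, D n -> Z), (forall n, smooth (a n)) ->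
     (forall n, a n.+1 \o d n =1 a n) ->
     exists! w : X -> Z, smooth w /\ forall n, w \o c n =1 a n].

Definition unit_interval : diffSpace R := @sub_space line `[0, 1].

Lemma endpoint_subproof (b : bool) : `[0, 1]%classic (b%:R : R).
Proof. by rewrite /= in_itv /=; case: b; rewrite lexx ler01. Qed.

(* The endpoints of [0,1] are indexed by booleans: false for 0, true for 1. *)
Definition endpoint (b : bool) : unit_interval :=
  exist _ (b%:R : R) (mem_set (endpoint_subproof b)).

Definition cube_set n : set (euclidean n) :=
  [set t | forall j : 'I_n, 0 <= t 0 j <= 1].

Definition boundary_set n : set (euclidean n) :=
  [set t | cube_set t /\ exists j : 'I_n, t 0 j = 0 \/ t 0 j = 1].

Definition cube n : diffSpace R := sub_space (@cube_set n).

Definition boundary n : diffSpace R := sub_space (@boundary_set n).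

Lemma boundary_sub_cube n : @boundary_set n `<=` @cube_set n.
Proof. by move=> t []. Qed.

Definition boundary_incl n : boundary n -> cube n :=
  sub_incl (@boundary_sub_cube n).

Definition subst_coord n (t : 'rV[R]_n) (j : 'I_n) (a : R) : 'rV[R]_n :=
  \row_i (if i == j then a else t 0 i).

(* In [tame_map], K is meant to be a cubical subcomplex of the n-cube: moving
   to the face t_j = b a point s of K with |s_j - b| <= e < 1 then gives a
   point t of K. *)
Definition tame_map n (K : set (euclidean n)) X (f : sub_space K -> X) :=
  exists2 e : R, 0 < e <= 2^-1 &
    forall (j : 'I_n) (b : bool) (s t : sub_space K),
      `|(sub_val s : 'rV[R]_n) 0 j - b%:R| <= e ->
      sub_val t = subst_coord (sub_val s) j b%:R ->
      f s = f t.

Definition tame_homotopy X Y (F : prod_space X unit_interval -> Y) :=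
  exists2 e : R, 0 < e <= 2^-1 &
    forall (x : X) (t : unit_interval) (b : bool),
      `|(sub_val t : R) - b%:R| <= e -> F (x, t) = F (x, endpoint b).

End Diffeology.

(* Given A = X^{-1} and sk n = X^n, this is n |-> X^{n-1}; it avoids casting
   along an equality of spaces in degree -1. *)
Definition lower_skel (R : realType) (A : diffSpace R)
    (sk : nat -> diffSpace R) (n : nat) : diffSpace R :=
  if n is m.+1 then sk m else A.

Record relCW (R : realType) (X : diffSpace R) (A : set X) := RelCW {
  skel : nat -> diffSpace R;
  cells : nat -> Type;
  skel_incl : forall n, lower_skel (sub_space A) skel n -> skel n;
  skel_inclP : forall n, inclusion (@skel_incl n);
  attach : forall n, cells n -> boundary n -> lower_skel (sub_space A) skel n;
  attach_smooth : forall n l, smooth (@attach n l);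
  cell_map : forall n, coprod_space (fun _ : cells n => cube n) -> skel n;
  skel_pushout : forall n,
    is_pushout (coprod_rec (@attach n))
               (coprod_map (fun _ : cells n => @boundary_incl R n))
               (@skel_incl n) (@cell_map n);
  to_total : forall n, lower_skel (sub_space A) skel n -> X;
  to_total_colim :
    @is_seq_colim R (lower_skel (sub_space A) skel) skel_incl X to_total;
  to_total0 : forall a : sub_space A, @to_total 0%N a = sub_val a
}.

Definition gathered (R : realType) (X : diffSpace R) (A : set X)
    (C : relCW A) :=
  forall n (l : cells C n), tame_map (@attach R X A C n l).

(* Main.v *)
Require Import Defs.
From mathcomp Require Import all_boot all_order all_algebra.
From mathcomp Require Import all_classical all_reals all_analysis.
From mathcomp Require Import ring lra.

Set Implicit Arguments.
Unset Strict Implicit.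
Unset Printing Implicit Defensive.

Import Order.TTheory GRing.Theory Num.Theory.
Import numFieldNormedType.Exports.
Local Open Scope classical_set_scope.
Local Open Scope ring_scope.

(* Write the homotopies as maps into the space of smooth paths of Y, so that
   they can be glued by the universal properties of the pushouts and of the
   colimit.  On a cell, let g be the restriction of f and k the given homotopy on
   the boundary, which is constant in time up to e'.  Pick e < e'.  Between the
   times e and e' the cell squashes a neighbourhood of its boundary onto the
   boundary, moving each coordinate that is close to 0 or 1; since the attaching
   map is tame, this does not change the values on the boundary.  After time e'
   that neighbourhood can follow k smoothly, up to a time that decreases from t
   on the boundary to less than e' inwards.  Each skeleton thus costs some
   tameness, which is spent along a sequence decreasing to half the tameness of
   h. *)

(** * A flat function *)

Section FlatFunction.
Context {R : realType}.

(** The functions $x^{-n}e^{-1/x}$, extended by $0$. The whole family is needed because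
    differentiation maps it into its own linear span. *)
Definition flat (n : nat) (x : R) : R :=
  if 0 < x then (x ^+ n)^-1 * expR (- x^-1) else 0.

Lemma flat_ge0 n x : 0 <= flat n x.
Proof.
rewrite /flat; case: ifP => // x0.
by rewrite mulr_ge0 ?expR_ge0 // invr_ge0 exprn_ge0 // ltW.
Qed.

(** With $y=1/x$ and $m=n+1$, $e^{y/m}\ge y/m$ gives $e^y\ge(y/m)^m$. The bound is used for the
    limit at $0$. *)
Lemma flat_le n x : `|flat n x| <= n.+1%:R ^+ n.+1 * `|x|.
Proof.
rewrite ger0_norm ?flat_ge0 // /flat; case: ifPn => [x0|_]; last first.
  by rewrite mulr_ge0 // exprn_ge0.
have y0 : 0 < x^-1 by rewrite invr_gt0.
have k0 : 0 < n.+1%:R :> R by rewrite ltr0n.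
have E : (x^-1 / n.+1%:R) ^+ n.+1 <= expR x^-1.
  rewrite -[X in expR X](divfK (lt0r_neq0 k0)) expRM_natr lerXn2r ?nnegrE.
  - by [].
  - by rewrite divr_ge0 // ltW.
  - exact: expR_ge0.
  - by apply: le_trans (expR_ge1Dx _); rewrite lerDr.
rewrite gtr0_norm // expRN -invfM invf_ple ?posrE; last 2 first.
- by rewrite mulr_gt0 ?expR_gt0 ?exprn_gt0.
- by rewrite mulr_gt0 ?exprn_gt0.
apply: le_trans (ler_wpM2l (exprn_ge0 n (ltW x0)) E).
have -> : x ^+ n * (x^-1 / n.+1%:R) ^+ n.+1 = (n.+1%:R ^+ n.+1 * x)^-1 => //.
rewrite expr_div_n exprVn [x ^+ n.+1]exprS.
set p := x ^+ n; set q := _ ^+ n.+1.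
have p0 : p != 0 by rewrite expf_neq0 // gt_eqF.
have q0 : q != 0 by rewrite expf_neq0 // gt_eqF.
by field; rewrite q0 p0 gt_eqF.
Qed.

Lemma is_derive_flat n (x : R) :
  is_derive x 1 (flat n) (- n%:R * flat n.+1 x + flat n.+2 x).
Proof.
case: (ltgtP x 0) => [x0|x0|->].
- rewrite /flat ltNge (ltW x0) /= mulr0 addr0.
  apply: (@near_eq_is_derive _ _ _ (cst 0)).
  near=> y; have y0 : y < 0 by near: y; exact: lt_nbhsl.
  by rewrite ltNge (ltW y0).
- rewrite /flat x0.
  apply: (@near_eq_is_derive _ _ _ (fun y : R => (y ^+ n)^-1 * expR (- y^-1))).
    near=> y; have y0 : 0 < y by near: y; exact: lt_nbhsr.
    by rewrite y0.
  have x_neq0 : x != 0 by rewrite gt_eqF.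
  have xn0 : (id ^+ n : R -> R) x != 0 by rewrite fctE expf_neq0.
  have dV := is_deriveV xn0 (is_deriveX n (is_derive_id x 1)).
  have dN := is_deriveN (@is_deriveV _ id x 1 1 x_neq0 (is_derive_id x 1)).
  have dE := @is_derive1_comp _ expR _ x _ _ (is_derive_expR (- x^-1)) dN.
  rewrite (_ : (fun y => _) = ((fun y => ((id ^+ n : R -> R) y)^-1) *
      (expR \o - (fun y => y^-1)))); last by apply/funext => y; rewrite !fctE.
  apply: (is_derive_eq (is_deriveM dV dE)).
  rewrite !fctE /= !scaler1 /GRing.scale /=.
  set E := expR _; case: n {xn0 dV} => [|n] /=.
    by rewrite !expr0 expr1 expr2 mulr0n; field.
  rewrite !(exprS x n.+2, exprS x n.+1, exprS x n).
  have pn : x ^+ n != 0 by rewrite expf_neq0.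
  by field; rewrite pn x_neq0.
(* At $0$ the difference quotient of [flat n] is [flat n.+1] itself, which tends to $0$ by
   [flat_le]. *)
- have E : (fun h => h^-1 *: ((flat n \o shift 0) (h *: 1) - flat n 0)) =
           flat n.+1.
    apply/funext => h; rewrite /= {2}/flat ltxx subr0 addr0 /GRing.scale /= mulr1.
    by rewrite /flat; case: ifP => h0; rewrite ?mulr0 // exprS invfM mulrA.
  have d0 : flat n.+1 @ 0^' --> (0 : R).
    apply/cvgr0Pnorm_le => e e0; set K : R := n.+2%:R ^+ n.+2.
    have K0 : 0 < K by rewrite exprn_gt0.
    near=> z; apply: le_trans (flat_le _ _) _; rewrite -ler_pdivlMl //.
    near: z; by apply: dnbhs0_le; rewrite mulr_gt0 ?invr_gt0.
  have c0 : derivable (flat n) 0 1.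
    by rewrite /derivable E; apply/cvg_ex; exists 0; exact: d0.
  split => //; rewrite /derive E (cvg_lim _ d0) // /flat ltxx mulr0 addr0 //.
Unshelve. all: by end_near. Qed.
End FlatFunction.

(** * Smooth functions *)

Section SmoothFunctions.
Context {R : realType}.

Definition smooth1 (u : R -> R) :=
  smooth_fun setT (fun v : 'rV[R]_1 => u (v 0 0)).

Lemma smooth1_comp (u : R -> R) n (U : set 'rV[R]_n) (v : 'rV[R]_n -> R) :
  open U -> smooth1 u -> smooth_fun U v -> smooth_fun U (fun x => u (v x)).
Proof.
move=> oU su sv.
have := @smooth_fun_comp R n 1 U setT (fun x => \row__ v x) _ oU _ _ su.
rewrite (_ : _ \o _ = fun x => u (v x)); last by apply/funext => x /=; rewrite mxE.
apply => // j; rewrite (_ : (fun x => _) = v) //.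
by apply/funext => x; rewrite mxE.
Qed.

Lemma derive_entry n (i j : 'I_n) (x : 'rV[R]_n) :
  'D_('e_i) (fun v : 'rV[R]_n => v 0 j) x = ('e_i : 'rV[R]_n) 0 j.
Proof.
rewrite (@derive_coord _ n n id x 'e_i j); last exact: ex_diff.
by rewrite diff_val.
Qed.

Lemma smooth_fun_coord n (U : set 'rV[R]_n) j :
  open U -> smooth_fun U (fun v => v 0 j).
Proof.
move=> oU [|k]; first by move=> x _; exact: coord_continuous.
split=> [x _|i]; first exact: differentiable_coord.
apply: Ck_ext (Ck_cst k U (('e_i : 'rV[R]_n) 0 j)) => //.
by move=> x _; rewrite /= derive_entry.
Qed.

(** Induction on the order of differentiability, for all [n] at once: the derivative of [flat n]
    combines [flat n.+1] and [flat n.+2]. *)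
Lemma smooth1_flat n : smooth1 (flat n).
Proof.
move=> k; elim: k n => [|k IH] n.
  move=> x _; apply: (@continuous_comp _ _ _ (fun v : 'rV[R]_1 => v 0 0)).
    exact: coord_continuous.
  apply: differentiable_continuous; apply/derivable1_diffP.
  by have := is_derive_flat n (x 0 0).
have df (x : 'rV[R]_1) : differentiable (flat n) (x 0 0).
  by apply/derivable1_diffP; have := is_derive_flat n (x 0 0).
have dc (x : 'rV[R]_1) : differentiable (fun v : 'rV[R]_1 => v 0 0) x.
  exact: differentiable_coord.
split=> [x _|i]; first exact: (differentiable_comp (dc x)).
have oT : open (@setT 'rV[R]_1) by exact: openT.
have H := Ck_add oT (Ck_mul oT (Ck_cst k setT (- n%:R)) (IH n.+1)) (IH n.+2).
apply: Ck_ext H => // x _ /=.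
rewrite [RHS](_ : _ = 'D_('e_i) (flat n \o (fun v : 'rV[R]_1 => v 0 0)) x) //.
rewrite deriveE; last exact: differentiable_comp.
rewrite diff_comp // [RHS](_ : _ = 'd (flat n) (x 0 0) 1); last first.
  have -> : 1 = ('e_i : 'rV[R]_1) 0 0 by rewrite mxE !ord1 !eqxx.
  by rewrite /= -(derive_entry i 0 x) deriveE //; exact: dc.
by rewrite -derive1E' // derive1E; have /@derive_val -> := is_derive_flat n (x 0 0).
Qed.

Lemma smooth_fun_cst n (U : set 'rV[R]_n) c : smooth_fun U (fun=> c).
Proof. by move=> k; exact: Ck_cst. Qed.

Lemma smooth_funD n (U : set 'rV[R]_n) u v : open U ->
  smooth_fun U u -> smooth_fun U v -> smooth_fun U (fun x => u x + v x).
Proof. by move=> oU su sv k; exact: Ck_add. Qed.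

Lemma smooth_funM n (U : set 'rV[R]_n) u v : open U ->
  smooth_fun U u -> smooth_fun U v -> smooth_fun U (fun x => u x * v x).
Proof. by move=> oU su sv k; exact: Ck_mul. Qed.

Lemma smooth_funN n (U : set 'rV[R]_n) u : open U ->
  smooth_fun U u -> smooth_fun U (fun x => - u x).
Proof.
move=> oU su; rewrite (_ : (fun _ => _) = fun x => -1 * u x).
  by apply: smooth_funM => //; exact: smooth_fun_cst.
by apply/funext => x; rewrite mulN1r.
Qed.

Lemma smooth_funB n (U : set 'rV[R]_n) u v : open U ->
  smooth_fun U u -> smooth_fun U v -> smooth_fun U (fun x => u x - v x).
Proof. by move=> oU su sv; apply: smooth_funD => //; exact: smooth_funN. Qed.

Lemma smooth_fun_prod n (U : set 'rV[R]_n) (I : Type) (s : seq I)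
    (u : I -> 'rV[R]_n -> R) : open U ->
  (forall i, smooth_fun U (u i)) -> smooth_fun U (fun x => \prod_(i <- s) u i x).
Proof.
move=> oU su; elim: s => [|i s IH].
  rewrite (_ : (fun _ => _) = fun=> 1); first exact: smooth_fun_cst.
  by apply/funext => x; rewrite big_nil.
rewrite (_ : (fun _ => _) = fun x => u i x * \prod_(j <- s) u j x).
  exact: smooth_funM.
by apply/funext => x; rewrite big_cons.
Qed.

Lemma smooth1P (u : R -> R) : (forall n (U : set 'rV[R]_n) v, open U ->
  smooth_fun U v -> smooth_fun U (fun x => u (v x))) -> smooth1 u.
Proof. by move=> H; apply: H; [exact: openT|exact/smooth_fun_coord/openT]. Qed.

Lemma open_smooth_lt n (U : set 'rV[R]_n) u c : open U -> smooth_fun U u ->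
  open (U `&` [set x | u x < c]).
Proof.
move=> oU su; rewrite openE => x [Ux uc]; apply: filterI.
  exact: open_nbhs_nbhs.
have cu : u @ x --> u x := su 0%N x Ux.
exact: cu (lt_nbhsl uc).
Qed.

Lemma open_smooth_preimage n m (U : set 'rV[R]_n) (V : set 'rV[R]_m) g :
  open U -> open V -> smooth_vec U g -> open (U `&` g @^-1` V).
Proof.
move=> oU oV sg; rewrite openE => x [Ux Vgx]; apply: filterI.
  exact: open_nbhs_nbhs.
have cg : {for x, continuous g} by apply: continuous_vec => j; exact: (sg j 0%N).
by apply: cg; exact: open_nbhs_nbhs.
Qed.

Lemma smooth_vec_sub n m (U V : set 'rV[R]_n) (g : 'rV[R]_n -> 'rV[R]_m) :
  V `<=` U -> smooth_vec U g -> smooth_vec V g.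
Proof. by move=> VU sg j k; exact: Ck_sub (sg j k). Qed.

Lemma smooth_vec_id n (U : set 'rV[R]_n) : open U -> smooth_vec U id.
Proof. by move=> oU j; exact: smooth_fun_coord. Qed.

End SmoothFunctions.

(** * Collapsing maps of the interval *)

Section Collapse.
Context {R : realType}.
Implicit Types a b u : R.

Lemma flat0_homo u v : u <= v -> flat 0 u <= flat 0 v.
Proof.
move=> uv; case: (ltP 0 u) => u0; last first.
  by rewrite {1}/flat ltNge u0 flat_ge0.
have v0 := lt_le_trans u0 uv.
by rewrite /flat u0 v0 !expr0 invr1 !mul1r ler_expR lerN2 lef_pV2.
Qed.

Lemma flat0_gt0 u : 0 < u -> 0 < flat 0 u.
Proof. by move=> u0; rewrite /flat u0 expr0 invr1 mul1r expR_gt0. Qed.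

Lemma flat0_le0 u : u <= 0 -> flat 0 u = 0.
Proof. by move=> u0; rewrite /flat ltNge u0. Qed.

(* Dividing by a constant only spares the smoothness of the inverse, which the
   usual [flat 0 u / (flat 0 u + flat 0 (1 - u))] would need.  The definition is
   locked because unification would otherwise unfold it down to [expR]. *)
Fact step_key : unit. Proof. exact: tt. Qed.
Definition step := locked_with step_key
  (fun u : R => 1 - flat 0 (flat 0 1 - flat 0 u) / flat 0 (flat 0 1)).

Lemma stepE u : step u = 1 - flat 0 (flat 0 1 - flat 0 u) / flat 0 (flat 0 1).
Proof. by rewrite /step unlock. Qed.

Lemma step_eq0 u : u <= 0 -> step u = 0.
Proof.
move=> u0; rewrite stepE (flat0_le0 u0) subr0 divff ?subrr //.
by rewrite gt_eqF // !flat0_gt0.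
Qed.

Lemma step_eq1 u : 1 <= u -> step u = 1.
Proof.
move=> u1; rewrite stepE [X in X / _]flat0_le0 ?mul0r ?subr0 //.
by rewrite subr_le0 flat0_homo.
Qed.

Lemma step_itv u : 0 <= step u <= 1.
Proof.
have c0 : 0 < flat 0 (flat 0 (1 : R)) by rewrite !flat0_gt0.
rewrite stepE subr_ge0 ler_pdivrMr // mul1r lerBlDr lerDl divr_ge0 ?flat_ge0 //.
by rewrite andbT flat0_homo // lerBlDr lerDl flat_ge0.
Qed.

Lemma smooth1_step : smooth1 step.
Proof.
rewrite /step unlock; apply: smooth1P => n U v oU sv; apply: smooth_funB => //.
  exact: smooth_fun_cst.
apply: smooth_funM => //; last exact: smooth_fun_cst.
apply: (smooth1_comp (u := flat 0)) => //; first exact: smooth1_flat.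
apply: smooth_funB => //; first exact: smooth_fun_cst.
by apply: smooth1_comp => //; exact: smooth1_flat.
Qed.

Definition ramp a b u := step ((u - a) / (b - a)).

Lemma ramp_eq0 a b u : a < b -> u <= a -> ramp a b u = 0.
Proof.
move=> ab ua; rewrite /ramp step_eq0 // mulr_le0_ge0 ?subr_le0 //.
by rewrite invr_ge0 subr_ge0 ltW.
Qed.

Lemma ramp_eq1 a b u : a < b -> b <= u -> ramp a b u = 1.
Proof.
by move=> ab bu; rewrite /ramp step_eq1 // ler_pdivlMr ?subr_gt0 // mul1r lerB.
Qed.

Lemma ramp_itv a b u : 0 <= ramp a b u <= 1.
Proof. exact: step_itv. Qed.

Lemma smooth1_ramp a b : smooth1 (ramp a b).
Proof.
apply: smooth1P => n U v oU sv.
apply: (smooth1_comp (u := step)) => //; first exact: smooth1_step.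
apply: smooth_funM => //; last exact: smooth_fun_cst.
by apply: smooth_funB => //; exact: smooth_fun_cst.
Qed.

(** For $a<b\le1/2$ this smooth map sends $[0,a]$ to $0$ and $[1-a,1]$ to $1$, and fixes $[b,1-b]$;
    in between it moves points towards the nearer endpoint. *)
Definition collapse a b u :=
  u * ramp a b u + (1 - u) * (1 - ramp a b (1 - u)).

Lemma smooth1_collapse a b : smooth1 (collapse a b).
Proof.
have s1 := smooth1_ramp a b.
apply: smooth1P => n U v oU sv; have c1 := @smooth_fun_cst R n U 1.
apply: smooth_funD => //; apply: smooth_funM => //.
- exact: smooth1_comp.
- exact: smooth_funB.
- apply: smooth_funB => //; apply: (smooth1_comp (u := ramp a b)) => //.
  exact: smooth_funB.
Qed.

Lemma collapseC a b u : collapse a b (1 - u) = 1 - collapse a b u.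
Proof. by rewrite /collapse subKr; ring. Qed.

Lemma collapse_low a b u : a < b -> b <= 2^-1 -> u <= a -> collapse a b u = 0.
Proof.
move=> ab b2 ua; rewrite /collapse ramp_eq0 // [ramp _ _ (1 - u)]ramp_eq1 //; last by lra.
by rewrite mulr0 subrr mulr0 addr0.
Qed.

Lemma collapse_high a b u : a < b -> b <= 2^-1 -> 1 - a <= u -> collapse a b u = 1.
Proof.
move=> ab b2 ua; rewrite -[u](subKr 1) collapseC collapse_low ?subr0 //; lra.
Qed.

Lemma collapse_le a b u : a < b -> b <= 2^-1 -> 0 <= u <= b -> 0 <= collapse a b u <= u.
Proof.
move=> ab b2 /andP[u0 ub]; rewrite /collapse [ramp _ _ (1 - u)]ramp_eq1 //; last by lra.
have /andP[r0 r1] := ramp_itv a b u.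
by rewrite subrr mulr0 addr0 mulr_ge0 //= ler_piMr.
Qed.

Lemma collapse_ge a b u : a < b -> b <= 2^-1 -> 1 - b <= u <= 1 -> u <= collapse a b u <= 1.
Proof.
move=> ab b2 /andP[u0 ub]; have : 0 <= 1 - u <= b by apply/andP; lra.
by move=> /(collapse_le ab b2); rewrite collapseC => /andP[? ?]; apply/andP; lra.
Qed.

Lemma collapse_mid a b u : a < b -> b <= 2^-1 -> b <= u <= 1 - b -> collapse a b u = u.
Proof.
move=> ab b2 /andP[u0 ub]; rewrite /collapse ramp_eq1 // ramp_eq1 //; last by lra.
by rewrite subrr mulr0 addr0 mulr1.
Qed.

Lemma collapse_itv a b u : a < b -> b <= 2^-1 -> 0 <= u <= 1 -> 0 <= collapse a b u <= 1.
Proof.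
move=> ab b2 /andP[u0 u1]; case: (leP u b) => ub.
  have /andP[? ?] : 0 <= collapse a b u <= u by apply: (collapse_le ab b2); rewrite u0.
  by apply/andP; lra.
case: (leP u (1 - b)) => ub'.
  by rewrite collapse_mid ?u0 // ltW.
have /andP[? ?] : u <= collapse a b u <= 1 by apply: (collapse_ge ab b2); rewrite u1 ltW.
by apply/andP; lra.
Qed.

End Collapse.

(** * The space of smooth paths *)

Section PathSpace.
Context {R : realType}.
Implicit Types X Y Z : diffSpace R.

Local Notation I := (@unit_interval R).

Lemma plot_sub X n (U V : set 'rV[R]_n) (p : 'rV[R]_n -> X) :
  plot X U p -> open V -> V `<=` U -> plot X V p.
Proof.
by move=> Up oV VU; apply: (plot_comp (g := id) Up) => //; exact: smooth_vec_id.
Qed.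

Lemma smooth_comp X Y Z (u : X -> Y) (v : Y -> Z) :
  smooth u -> smooth v -> smooth (v \o u).
Proof. by move=> su sv n U p /su /sv. Qed.

#[local] Obligation Tactic := idtac.

(* Smooth paths with the functional diffeology, the exponential making
   diffeological spaces cartesian closed. *)
Program Definition path_space Y : diffSpace R := {|
  carrier := {c : I -> Y | smooth c};
  plot := fun n U p => open U /\
    forall m (V : set 'rV[R]_m) (g : 'rV[R]_m -> 'rV[R]_n) (r : 'rV[R]_m -> I),
      plot I V r -> smooth_vec V g -> (forall y, V y -> U (g y)) ->
      plot Y V (fun y => sval (p (g y)) (r y))
|}.
Next Obligation.
by move=> Y n U p [].
Qed.
Next Obligation.
move=> Y n U p q pq [oU Hp]; split=> // m V g r Vr sg VU.
by apply: plot_ext (Hp _ _ _ _ Vr sg VU) => y Vy; rewrite pq //; exact: VU.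
Qed.
Next Obligation.
by move=> Y n U c oU; split=> // m V g r Vr _ _; exact: (svalP c).
Qed.
Next Obligation.
move=> Y n U p oU Hp; split=> // m V g r Vr sg VU; have oV := plot_open Vr.
apply: plot_local => // y Vy.
have [W [Wy WU [oW HW]]] := Hp _ (VU _ Vy).
have oVW := open_smooth_preimage oV oW sg.
exists (V `&` g @^-1` W); split; [by []|by move=> z []|].
apply: HW; first by apply: plot_sub Vr oVW _ => z [].
  by apply: smooth_vec_sub sg => z [].
by move=> z [].
Qed.
Next Obligation.
move=> Y n m U V p g [oU Hp] oV sg VU; split=> // k W q r Wr sq WV.
apply: (Hp _ _ (g \o q)) => //.
  move=> j; apply: (smooth_fun_comp (plot_open Wr) WV sq (sg j)).
by move=> y /WV /VU.
Qed.

Lemma path_space_eq Y (c d : path_space Y) : sval c =1 sval d -> c = d.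
Proof.
case: c d => [c sc] [d sd] /= /funext cd.
by move: sd; rewrite -cd => sd; rewrite (Prop_irrelevance sc sd).
Qed.

(** The exponential law. To uncurry, the plot condition is tested with [g] the identity; to curry, a
    plot of [X] is precomposed with [g]. *)
Lemma smooth_path_space X Y (u : X -> path_space Y) :
  smooth u <->
  smooth (fun x : prod_space X I => sval (u x.1) x.2).
Proof.
split=> su n U p.
  move=> [Up1 Up2]; have oU := plot_open Up1; have [_ H] := su _ _ _ Up1.
  by apply: (H n U id (fun y => (p y).2)) => //; exact: smooth_vec_id.
move=> Up; split; first exact: plot_open Up.
move=> m V g r Vr sg VU.
apply: (su _ _ (fun y => (p (g y), r y))); split=> //=.
by apply: (plot_comp Up) => //; exact: plot_open Vr.
Qed.

Lemma smooth_slice X Y (G : prod_space X I -> Y) x :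
  smooth G -> smooth (fun t : I => G (x, t)).
Proof.
move=> sG n U p Up; apply: (sG _ _ (fun y => (x, p y))); split=> //=.
by apply: plot_cst; exact: plot_open Up.
Qed.

Definition curry_path X Y (G : prod_space X I -> Y) (sG : smooth G) (x : X) :
  path_space Y := exist _ (fun t => G (x, t)) (smooth_slice x sG).

Lemma smooth_curry_path X Y (G : prod_space X I -> Y) (sG : smooth G) :
  smooth (curry_path sG).
Proof.
apply/smooth_path_space => n U p Up.
by apply: plot_ext (sG _ _ _ Up) => x _ /=; case: (p x).
Qed.

Lemma smooth_eval Y (t : I) : smooth (fun c : path_space Y => sval c t).
Proof.
move=> n U p [oU Hp]; apply: (Hp n U id (fun=> t)) => //.
  exact: plot_cst.
exact: smooth_vec_id.
Qed.

End PathSpace.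

(** * Squashing a cube onto its boundary near the boundary *)

Section Squash.
Context {R : realType}.
Implicit Types (a b e s u : R).

Definition sub_mk (X : diffSpace R) (A : set X) x (Ax : A x) : sub_space A :=
  exist _ x (mem_set Ax).

(** The normal form of a coordinate up to the identifications made by a tame map. *)
Definition round b u := if u <= b then 0 else if 1 - b <= u then 1 else u.

(** The coordinates are rounded one at a time: each move to a face leaves [phi] unchanged and stays
    in the boundary, since the moved coordinate becomes 0 or 1. Both points end at the same fully
    rounded point. *)
Lemma tame_round n (B : diffSpace R) (phi : boundary n -> B) b :
  (forall (j : 'I_n) (al : bool) (s t : boundary n),
     `|(sub_val s : 'rV[R]_n) 0 j - al%:R| <= b ->
     sub_val t = subst_coord (sub_val s) j al%:R -> phi s = phi t) ->
  forall s t : boundary n,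
    (forall j, round b ((sub_val s : 'rV[R]_n) 0 j) =
               round b ((sub_val t : 'rV[R]_n) 0 j)) -> phi s = phi t.
Proof.
move=> tame.
have rd (s : boundary n) (l : seq 'I_n) : exists2 t : boundary n, phi s = phi t &
    forall j, (sub_val t : 'rV[R]_n) 0 j =
      if j \in l then round b ((sub_val s : 'rV[R]_n) 0 j)
      else (sub_val s : 'rV[R]_n) 0 j.
  elim: l => [|i l [t st tl]]; first by exists s.
  have [il|il] := boolP (i \in l).
    by exists t => // j; rewrite tl in_cons; case: eqP => // ->; rewrite il.
  have [tc _] := set_mem (valP t).
  have move_to (al : bool) : `|(sub_val t : 'rV[R]_n) 0 i - al%:R| <= b ->
      round b ((sub_val t : 'rV[R]_n) 0 i) = al%:R ->
      exists2 t : boundary n, phi s = phi t &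
      forall j, (sub_val t : 'rV[R]_n) 0 j =
        if j \in i :: l then round b ((sub_val s : 'rV[R]_n) 0 j)
        else (sub_val s : 'rV[R]_n) 0 j.
    move=> tial ral.
    have bd : @boundary_set R n (subst_coord (sub_val t) i al%:R).
      split=> [j|]; first by rewrite mxE; case: eqP => // _; case: al {tial ral};
        rewrite lexx ler01.
      by exists i; rewrite mxE eqxx; case: al {tial ral}; [right|left].
    exists (sub_mk bd); first by rewrite st; exact: tame tial _.
    move=> j; rewrite /= mxE in_cons; case: eqP => [->|_] //=.
    by rewrite -ral tl (negbTE il).
  have /andP[ti0 ti1] := tc i.
  case: (leP ((sub_val t : 'rV[R]_n) 0 i) b) => tib.
    by apply: (move_to false); [rewrite subr0 ger0_norm|rewrite /round tib].
  case: (leP (1 - b) ((sub_val t : 'rV[R]_n) 0 i)) => tib'.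
    apply: (move_to true); last by rewrite /round leNgt tib tib'.
    by rewrite distrC ger0_norm ?subr_ge0 //= lerBlDr -lerBlDl.
  exists t => // j; rewrite tl in_cons; case: eqP => [->|//]; rewrite (negbTE il) /=.
  have := tl i; rewrite (negbTE il) => <-.
  by rewrite /round leNgt tib leNgt tib'.
move=> s t st.
have [s' -> Es] := rd s (enum 'I_n); have [t' -> Et] := rd t (enum 'I_n).
congr phi; apply: val_inj; apply/rowP => j.
by have := Es j; have := Et j; rewrite /sub_val !mem_enum !inE /= => -> ->.
Qed.

Definition squash a b s n (x : 'rV[R]_n) : 'rV[R]_n :=
  \row_j ((1 - s) * x 0 j + s * collapse a b (x 0 j)).

Lemma squash0 a b n (x : 'rV[R]_n) : squash a b 0 x = x.
Proof. by apply/rowP => j; rewrite mxE subr0 mul1r mul0r addr0. Qed.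

Lemma ge_conv s l u v : 0 <= s <= 1 -> l <= u -> l <= v ->
  l <= (1 - s) * u + s * v.
Proof.
move=> /andP[s0 s1] lu lv; have -> : l = (1 - s) * l + s * l by ring.
by rewrite lerD // ler_wpM2l // subr_ge0.
Qed.

Lemma le_conv s l u v : 0 <= s <= 1 -> u <= l -> v <= l ->
  (1 - s) * u + s * v <= l.
Proof.
move=> /andP[s0 s1] lu lv; have -> : l = (1 - s) * l + s * l by ring.
by rewrite lerD // ler_wpM2l // subr_ge0.
Qed.

Lemma squash_cube a b s n (x : 'rV[R]_n) : a < b -> b <= 2^-1 ->
  0 <= s <= 1 -> @cube_set R n x -> @cube_set R n (squash a b s x).
Proof.
move=> ab b2 s01 xc j; rewrite mxE.
have /andP[x0 x1] := xc j.
have /andP[c0 c1] := collapse_itv ab b2 (xc j).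
by rewrite ge_conv // le_conv.
Qed.

(** Squashing moves a coordinate only inside $[0,b]$ or inside $[1-b,1]$, so a tame map on the
    boundary cannot detect it. *)
Lemma squash_round a b s n (x : 'rV[R]_n) j : a < b -> b < 2^-1 ->
  0 <= s <= 1 -> @cube_set R n x ->
  round b (squash a b s x 0 j) = round b (x 0 j).
Proof.
move=> ab b2 s01 xc; rewrite mxE.
have /andP[x0 x1] := xc j; have b2' := ltW b2.
case: (leP (x 0 j) b) => xb.
  have xb' : 0 <= x 0 j <= b by rewrite x0.
  have /andP[c0 c1] := collapse_le ab b2' xb'.
  by rewrite /round xb ifT // le_conv // (le_trans c1).
case: (leP (1 - b) (x 0 j)) => xb'.
  have xb2 : 1 - b <= x 0 j <= 1 by rewrite xb'.
  have /andP[c0 c1] := collapse_ge ab b2' xb2.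
  have E : x 0 j <= (1 - s) * x 0 j + s * collapse a b (x 0 j) by rewrite ge_conv.
  rewrite /round [X in if X then _ else _]leNgt (lt_le_trans xb E) /=.
  by rewrite (le_trans xb' E) leNgt xb xb'.
rewrite collapse_mid //; last by rewrite !ltW.
by congr round; ring.
Qed.

Lemma squash_face a b s n (x : 'rV[R]_n) : 0 <= a -> a < b -> b <= 2^-1 ->
  0 <= s <= 1 -> @boundary_set R n x -> @boundary_set R n (squash a b s x).
Proof.
move=> a0 ab b2 s01 [xc [j xj]]; split; first exact: squash_cube.
exists j; rewrite mxE; case: xj => ->; [left|right].
  by rewrite collapse_low // !mulr0 addr0.
by rewrite collapse_high // ?lerBlDr ?lerDl // !mulr1 subrK.
Qed.

Lemma squash1_boundary a b n (x : 'rV[R]_n) j : a < b -> b <= 2^-1 ->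
  @cube_set R n x -> x 0 j <= a \/ 1 - a <= x 0 j ->
  @boundary_set R n (squash a b 1 x).
Proof.
move=> ab b2 xc xj; split.
  by apply: squash_cube; rewrite ?ler01 ?lexx.
exists j; rewrite mxE subrr mul0r add0r mul1r.
by case: xj => xj; [left; exact: collapse_low|right; exact: collapse_high].
Qed.

Lemma smooth_squash a b m n (U : set 'rV[R]_m)
    (s : 'rV[R]_m -> R) (x : 'rV[R]_m -> 'rV[R]_n) :
  open U -> smooth_fun U s -> smooth_vec U x ->
  smooth_vec U (fun y => squash a b (s y) (x y)).
Proof.
move=> oU ss sx j.
rewrite (_ : (fun _ => _) = fun y => (1 - s y) * x y 0 j +
   s y * collapse a b (x y 0 j)); last by apply/funext => y; rewrite mxE.
have xj := sx j; apply: smooth_funD => //; apply: smooth_funM => //.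
  by apply: smooth_funB => //; exact: smooth_fun_cst.
by apply: (smooth1_comp (u := collapse a b)) => //; exact: smooth1_collapse.
Qed.

(** A smooth cutoff: 1 on the boundary, where some factor vanishes, and 0 at distance at least [a]
    from every face. *)
Definition collar a n (x : 'rV[R]_n) : R :=
  1 - \prod_j (ramp 0 a (x 0 j) * ramp 0 a (1 - x 0 j)).

Lemma collar_itv a n (x : 'rV[R]_n) : 0 <= collar a x <= 1.
Proof.
rewrite /collar subr_ge0 lerBlDr lerDl; apply/andP; split.
  apply: prodr_ile1 => j _; have /andP[? ?] := ramp_itv 0 a (x 0 j).
  have /andP[? ?] := ramp_itv 0 a (1 - x 0 j).
  by apply/andP; split; [exact: mulr_ge0|exact: mulr_ile1].
apply: prodr_ge0 => j _; have /andP[? ?] := ramp_itv 0 a (x 0 j).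
by have /andP[? ?] := ramp_itv 0 a (1 - x 0 j); exact: mulr_ge0.
Qed.

Lemma collar_boundary a n (x : 'rV[R]_n) : 0 < a ->
  @boundary_set R n x -> collar a x = 1.
Proof.
move=> a0 [xc [j xj]]; rewrite /collar (bigD1 j) //=.
have r0 : ramp 0 a 0 = 0 by exact: ramp_eq0.
by case: xj => ->; rewrite ?subrr r0 ?mulr0 !mul0r subr0.
Qed.

Lemma collar_eq0 a n (x : 'rV[R]_n) : 0 < a ->
  (forall j, a <= x 0 j <= 1 - a) -> collar a x = 0.
Proof.
move=> a0 xa; rewrite /collar big1 ?subrr // => j _.
by have /andP[? ?] := xa j; rewrite !ramp_eq1 ?mulr1 //; lra.
Qed.

Lemma smooth_collar a m n (U : set 'rV[R]_m) (x : 'rV[R]_m -> 'rV[R]_n) :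
  open U -> smooth_vec U x -> smooth_fun U (fun y => collar a (x y)).
Proof.
move=> oU sx; apply: smooth_funB => //; first exact: smooth_fun_cst.
apply: (@smooth_fun_prod R m U _ _ (fun j y =>
  ramp 0 a (x y 0 j) * ramp 0 a (1 - x y 0 j))) => // j.
have s1 := smooth1_ramp (0 : R) a; have xj := sx j.
apply: smooth_funM => //; first exact: smooth1_comp.
apply: (smooth1_comp (u := ramp 0 a)) => //.
by apply: smooth_funB => //; exact: smooth_fun_cst.
Qed.

End Squash.

(** * Extension of a homotopy over a cell *)

Section CellHomotopy.
Context {R : realType}.
Implicit Types (X Y : diffSpace R) (a b e u : R).

Local Notation I := (@unit_interval R).

Definition path_tame e Y (c : I -> Y) :=
  forall (t : I) (al : bool), `|(sub_val t : R) - al%:R| <= e ->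
    c t = c (endpoint al).

Lemma path_tame_le e e' Y (c : I -> Y) :
  e <= e' -> path_tame e' c -> path_tame e c.
Proof. by move=> ee' tc t al te; apply: tc; exact: le_trans te ee'. Qed.

Lemma interval_itv (t : I) : 0 <= (sub_val t : R) <= 1.
Proof. by have := set_mem (valP t); rewrite /= in_itv. Qed.

Lemma interval_mem u : 0 <= u <= 1 -> (`[0, 1]%classic : set (@line R)) u.
Proof. by rewrite /= in_itv. Qed.

Lemma path_tame_low e Y (c : I -> Y) (t : I) : path_tame e c ->
  (sub_val t : R) <= e -> c t = c (endpoint false).
Proof.
move=> tc te; apply: tc; have /andP[t0 _] := interval_itv t.
by rewrite subr0 ger0_norm.
Qed.

Lemma path_tame_high e Y (c : I -> Y) (t : I) : path_tame e c ->
  1 - e <= (sub_val t : R) -> c t = c (endpoint true).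
Proof.
move=> tc te; apply: tc; have /andP[_ t1] := interval_itv t.
by rewrite distrC ger0_norm ?subr_ge0 //= lerBlDr -lerBlDl.
Qed.

(** [collapse e e'] moves only times in $[0,e']$ and $[1-e',1]$, keeping them in the same interval,
    and [c] is constant on each of these. *)
Lemma path_tame_collapse e e' Y (c : I -> Y) (t t' : I) :
  e < e' -> e' <= 2^-1 -> path_tame e' c ->
  (sub_val t' : R) = collapse e e' (sub_val t) -> c t' = c t.
Proof.
move=> ee' e'2 tc tt'; have /andP[t0 t1] := interval_itv t.
case: (leP (sub_val t : R) e') => te.
  have te' : 0 <= (sub_val t : R) <= e' by rewrite t0.
  have /andP[_ le] := collapse_le ee' e'2 te'.
  by rewrite !(path_tame_low tc) // tt' (le_trans le).
case: (leP (1 - e') (sub_val t : R)) => te'.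
  have te2 : 1 - e' <= (sub_val t : R) <= 1 by rewrite te'.
  have /andP[le _] := collapse_ge ee' e'2 te2.
  by rewrite !(path_tame_high tc) // tt' (le_trans te').
have E : (sub_val t' : R) = sub_val t.
  by rewrite tt' collapse_mid // !ltW.
by congr c; exact: val_inj.
Qed.

Lemma path_tame_itv e Y (c : I -> Y) :
  (forall t t' : I, (sub_val t : R) <= e -> (sub_val t' : R) <= e -> c t = c t') ->
  (forall t t' : I, 1 - e <= (sub_val t : R) -> 1 - e <= (sub_val t' : R) ->
     c t = c t') -> 0 <= e -> path_tame e c.
Proof.
move=> low high e0 t [] /=.
  rewrite ler_norml => /andP[te _]; apply: high.
    by rewrite lerBrDr addrC in te.
  by rewrite -[leRHS]/(1 : R) gerBl.
rewrite ler_norml subr0 => /andP[_ te]; exact: low.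
Qed.

(* Up to time [e'] the cell only deforms itself, by squashing a neighbourhood of
   its boundary onto the boundary; this is invisible on the boundary since the
   attaching map is tame.  From then on, near the boundary, the cell follows
   [k] along the squashing, up to a time that decreases to [0] inwards. *)
Lemma cell_homotopy n Y (g : cube n -> Y)
    (k : prod_space (boundary n) I -> Y) e e' :
  0 < e -> e < e' -> e' <= 2^-1 -> smooth g -> smooth k ->
  (forall x, k (x, endpoint false) = g (boundary_incl x)) ->
  (forall x, path_tame e' (fun t => k (x, t))) ->
  (exists2 b, 0 < b <= 2^-1 & forall (j : 'I_n) (al : bool) (s s' : boundary n) t,
     `|(sub_val s : 'rV[R]_n) 0 j - al%:R| <= b ->
     sub_val s' = subst_coord (sub_val s) j al%:R -> k (s, t) = k (s', t)) ->
  exists G : prod_space (cube n) I -> Y, [/\ smooth G,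
    forall x, path_tame e (fun t => G (x, t)),
    forall x t, G (boundary_incl x, t) = k (x, t) &
    forall x, G (x, endpoint false) = g x].
Proof.
move=> e0 ee' e'2 sg sk kg kt [b0 /andP[b00 b02] kx].
(* Halving [b0] makes [b] strictly smaller than 1/2; [a] is the width of the collar. The squashing
   ends at time [e2], and the gap up to [e'] lets the open sets used for smoothness overlap. *)
pose b := b0 / 2; pose a := b0 / 4; pose e2 := (e + e') / 2.
have a0 : 0 < a by rewrite /a; lra.
have ab : a < b by rewrite /a /b; lra.
have bb0 : b <= b0 by rewrite /b; lra.
have b2 : b < 2^-1 by rewrite /b; lra.
have b2' := ltW b2.
have ee2 : e < e2 by rewrite /e2; lra.
have e2e' : e2 < e' by rewrite /e2; lra.
have e'0 : 0 < e' by lra.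
have kr (s s' : boundary n) t :
    (forall j, round b ((sub_val s : 'rV[R]_n) 0 j) =
               round b ((sub_val s' : 'rV[R]_n) 0 j)) -> k (s, t) = k (s', t).
  move=> ss'; apply: (@tame_round _ n Y (fun x => k (x, t)) b _ s s' ss') => j al r r' rb.
  by apply: kx; exact: le_trans rb bb0.
pose xv (z : prod_space (cube n) I) : 'rV[R]_n := sub_val z.1.
pose tv (z : prod_space (cube n) I) : R := sub_val z.2.
have xc z : @cube_set R n (xv z) by exact: set_mem (valP z.1).
have t01 z : 0 <= tv z <= 1 by exact: interval_itv.
(* The time at which [k] is followed; [collapse] instead of the time itself makes it constant near
   both ends. *)
pose level z := collar a (xv z) * collapse e e' (tv z).
have level01 z : 0 <= level z <= 1.
  have /andP[? ?] := collar_itv a (xv z).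
  have /andP[? ?] := collapse_itv ee' e'2 (t01 z).
  by apply/andP; split; [exact: mulr_ge0|exact: mulr_ile1].
have sq z : @cube_set R n (squash a b (ramp e e2 (tv z)) (xv z)).
  by apply: squash_cube => //; exact: ramp_itv.
pose Q z : cube n := sub_mk (sq z).
pose L z : I := sub_mk (interval_mem (level01 z)).
(* In effect [g] below level [e'] and [k] from there on: if the squashed point is not in the
   boundary, no coordinate is within [a] of a face and the level is 0. *)
pose G z := if pselect (@boundary_set R n (squash a b 1 (xv z))) is left P
  then if level z < e' then g (Q z) else k (sub_mk P, L z) else g (Q z).
have G1 z : level z < e' -> G z = g (Q z).
  by rewrite /G; case: pselect => // P ->.
(* After [e2] the squashing is complete, so the two formulas agree below level [e']: there [k] still
   has its initial value, which is given by [g]. *)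
have G2 z (P : @boundary_set R n (squash a b 1 (xv z))) : e2 <= tv z ->
    G z = k (sub_mk P, L z).
  move=> tz; rewrite /G; case: pselect => // P'; rewrite (Prop_irrelevance P' P).
  case: ifP => // lz; rewrite (path_tame_low (kt _)) //= ?ltW // kg.
  congr g; apply: val_inj; rewrite /= ramp_eq1 //.
(* Time enters only through these two functions, both constant on $[0,e]$ and on $[1-e,1]$; hence
   the tameness of [G]. *)
have GE x (t t' : I) : collapse e e' (sub_val t) = collapse e e' (sub_val t') ->
    ramp e e2 (sub_val t) = ramp e e2 (sub_val t') -> G (x, t) = G (x, t').
  move=> ct rt.
  have lE : level (x, t) = level (x, t') by rewrite /level /tv ct.
  have QE : Q (x, t) = Q (x, t') by apply: val_inj; rewrite /= /tv rt.
  have LE : L (x, t) = L (x, t') by apply: val_inj.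
  by rewrite /G QE LE lE.
exists G; split.
- move=> m U p [Up1 Up2]; have oU := plot_open Up1.
  have sx : smooth_vec U (fun y => xv (p y)) by case: Up1.
  have st : smooth_fun U (fun y => tv (p y)) by case: Up2.
  have sr : smooth_fun U (fun y => ramp e e2 (tv (p y))).
    by apply: (smooth1_comp (u := ramp e e2)) => //; exact: smooth1_ramp.
  have sl : smooth_fun U (fun y => level (p y)).
    apply: smooth_funM => //; first exact: smooth_collar.
    by apply: (smooth1_comp (u := collapse e e')) => //; exact: smooth1_collapse.
  apply: plot_local => // y0 Uy0.
  (* Smoothness is checked locally on two kinds of open sets: levels below [e'], where [G] is given
     by [g], and times after [e2] near a face, where it is given by [k]. *)
  have inside : level (p y0) < e' ->
      exists V, [/\ V y0, V `<=` U & plot Y V (G \o p)].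
    move=> ly0; have oV := open_smooth_lt (c := e') oU sl.
    exists (U `&` [set y | level (p y) < e']); split=> //.
    apply: (@plot_ext _ Y _ _ (g \o (Q \o p))).
      by move=> y [_ ly]; rewrite /= G1.
    apply: sg; split=> //.
    apply: (@smooth_vec_sub _ _ _ U); first by move=> y [].
    exact: smooth_squash.
  have collared V : open V -> V `<=` U -> V y0 ->
      (forall y, V y -> e2 <= tv (p y) /\
                        @boundary_set R n (squash a b 1 (xv (p y)))) ->
      exists V, [/\ V y0, V `<=` U & plot Y V (G \o p)].
    move=> oV VU Vy0 Vb; exists V; split=> //.
    have [_ P0] := Vb _ Vy0.
    (* Plots are total functions; [P0] supplies a value outside [V], where none matters. *)
    pose q y : boundary n :=
      if pselect (@boundary_set R n (squash a b 1 (xv (p y)))) is left P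
      then sub_mk P else sub_mk P0.
    have qE y : V y -> sub_val (q y) = squash a b 1 (xv (p y)).
      by move=> /Vb[_ P]; rewrite /q; case: pselect.
    apply: (@plot_ext _ Y _ _ (k \o (fun y => (q y, L (p y))))).
      move=> y Vy; have [ty P] := Vb _ Vy; rewrite /= (G2 _ P) //.
      by congr (k (_, _)); apply: val_inj; exact: qE.
    apply: sk; split => /=.
      apply: (@plot_ext _ (euclidean n) _ V (fun y => squash a b 1 (xv (p y)))).
        by move=> y Vy; rewrite -qE.
      split=> //; apply: (@smooth_vec_sub _ _ _ U) => //.
      by apply: smooth_squash => //; exact: smooth_fun_cst.
    by split=> // i; exact: Ck_sub (sl i).
  (* These sets cover everything: up to [e2] the level is at most the time, hence less than [e'];
     away from all faces it is 0; what remains is late and close to a face. *)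
  have /andP[? c1] := collar_itv a (xv (p y0)).
  case: (leP (tv (p y0)) e2) => ty0.
    have t0e' : 0 <= tv (p y0) <= e'.
      by have /andP[-> _] := t01 (p y0); rewrite (le_trans ty0 (ltW e2e')).
    have /andP[? ct] := collapse_le ee' e'2 t0e'.
    apply: inside; apply: le_lt_trans e2e'; apply: le_trans ty0.
    by apply: le_trans ct; exact: ler_piMl.
  case: (pselect (forall j, a <= xv (p y0) 0 j <= 1 - a)) => [mid|].
    by apply: inside; rewrite /level collar_eq0 // mul0r.
  move=> /existsNP[j /negP]; rewrite negb_and -!ltNge => xj.
  have s1 : smooth_fun U (fun=> 1 : R) by exact: smooth_fun_cst.
  have oT : open (U `&` [set y | - tv (p y) < - e2]).
    by apply: open_smooth_lt => //; exact: smooth_funN.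
  case/orP: xj => xj.
    apply: (collared (U `&` [set y | - tv (p y) < - e2] `&`
                      (U `&` [set y | xv (p y) 0 j < a]))).
    + by apply: openI => //; apply: open_smooth_lt => //; exact: sx.
    + by move=> y [[]].
    + by split; split=> //=; rewrite ltrN2.
    + move=> y [[_ /=]]; rewrite ltrN2 => ty [_ /= xy]; split; first exact: ltW.
      by apply: (squash1_boundary (j := j)) => //; left; exact: ltW.
  apply: (collared (U `&` [set y | - tv (p y) < - e2] `&`
                      (U `&` [set y | 1 - xv (p y) 0 j < a]))).
  + apply: openI => //; apply: open_smooth_lt => //.
    by apply: smooth_funB => //; exact: sx.
  + by move=> y [[]].
  + by split; split=> //=; rewrite ?ltrN2 // ltrBlDl -ltrBlDr.
  + move=> y [[_ /=]]; rewrite ltrN2 => ty [_ /= xy]; split; first exact: ltW.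
    by apply: (squash1_boundary (j := j)) => //; right; rewrite lerBlDl -lerBlDr ltW.
- move=> x; apply: path_tame_itv => [t t' te te'|t t' te te'|]; last exact: ltW.
    by apply: GE; rewrite ?(collapse_low ee') ?(ramp_eq0 ee2).
  have h : e2 <= 1 - e by lra.
  by apply: GE; rewrite ?(collapse_high ee') ?(ramp_eq1 ee2) // (le_trans h).
- move=> x t; have bx := set_mem (valP x).
  have c1 : collar a (xv (boundary_incl x, t)) = 1 by exact: collar_boundary.
  (* On the boundary the level is [collapse e e' t], a change of time that the tame path does not
     notice. *)
  have kL : k (x, L (boundary_incl x, t)) = k (x, t).
    apply: (@path_tame_collapse e e' _ (fun t => k (x, t))) => //.
    by rewrite [LHS](_ : _ = level (boundary_incl x, t)) // /level c1 mul1r.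
  case: (ltP (level (boundary_incl x, t)) e') => lt.
    (* Here [k] at [x] still has its initial value, and squashing [x] gives a boundary point with
       the same rounded coordinates. *)
    rewrite G1 // -kL (path_tame_low (kt x)) ?ltW //.
    have bs : @boundary_set R n (squash a b (ramp e e2 (sub_val t)) (sub_val x)).
      by apply: squash_face => //; [exact: ltW|exact: ramp_itv].
    have -> : Q (boundary_incl x, t) = boundary_incl (sub_mk bs) by exact: val_inj.
    rewrite -kg; apply: kr => j; apply: squash_round => //; first exact: ramp_itv.
    by case: bx.
  have bs : @boundary_set R n (squash a b 1 (sub_val x)).
    by apply: squash_face => //; rewrite ?ler01 ?lexx // ltW.
  rewrite /G; case: pselect => // P; rewrite ltNge lt /= -kL.
  by apply: kr => j; apply: squash_round; rewrite ?ler01 ?lexx //; case: bx.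
- move=> x; rewrite G1; last by rewrite /level collapse_low ?mulr0 // ltW.
  by congr g; apply: val_inj; rewrite /= ramp_eq0 ?squash0 // ltW.
Qed.

End CellHomotopy.

(** * Extension over the skeleta *)

Section Extension.
Context {R : realType}.
Implicit Types X Y Z : diffSpace R.

Local Notation I := (@unit_interval R).

Lemma smooth_coprod_rec (L : Type) (E : L -> diffSpace R) X
    (u : forall l, E l -> X) : (forall l, smooth (u l)) -> smooth (coprod_rec u).
Proof.
move=> su n U p [oU Hp]; apply: plot_local => // x /Hp[V [l [q [Vx VU Vq pq]]]].
exists V; split=> //; apply: plot_ext (su _ _ _ _ Vq) => y Vy /=.
by rewrite pq.
Qed.

Lemma smooth_coprod_inj (L : Type) (E : L -> diffSpace R) l :
  smooth (fun x : E l => existT _ l x : coprod_space E).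
Proof.
move=> n U p Up; split; first exact: plot_open Up.
by move=> x Ux; exists U, l, p; split.
Qed.

Lemma smooth_sub_val X (A : set X) : smooth (@sub_val R X A).
Proof. by []. Qed.

(** With this subspace as target of the universal properties, the glued maps are tame at every point
    by construction. *)
Definition tame_path_space e Y : diffSpace R :=
  sub_space [set c : path_space Y | path_tame e (sval c)].

(** Both maps solve the same universal problem, so uniqueness identifies them; no description of the
    points of [P] is required. *)
Lemma pushout_eq (S A B P : diffSpace R) (i : S -> A) (j : S -> B)
    (u : A -> P) (v : B -> P) Z (w w' : P -> Z) : is_pushout i j u v ->
  smooth w -> smooth w' -> w \o u =1 w' \o u -> w \o v =1 w' \o v -> w =1 w'.
Proof.
move=> [su sv uv up] sw sw' wu wv.
have [|w0 [_ uniq]] := up Z (w \o u) (w \o v) (smooth_comp su sw) (smooth_comp sv sw).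
  by move=> x; have /(congr1 w) := uv x.
have <- : w0 = w by exact: uniq.
by have <- : w0 = w' by apply: uniq; split.
Qed.

Lemma seq_colim_eq (D : nat -> diffSpace R) (d : forall n, D n -> D n.+1) X
    (c : forall n, D n -> X) Z (w w' : X -> Z) : is_seq_colim d c ->
  smooth w -> smooth w' -> (forall n, w \o c n =1 w' \o c n) -> w =1 w'.
Proof.
move=> [sc cd up] sw sw' wc.
have [n||w0 [_ uniq]] := up Z (fun n => w \o c n).
- exact: smooth_comp.
- by move=> n x; have /(congr1 w) := cd n x.
have <- : w0 = w by exact: uniq.
by have <- : w0 = w' by apply: uniq; split=> // n x; rewrite wc.
Qed.

(** * From one skeleton to the next *)

Section Cells.
Variables (X : diffSpace R) (A : set X) (C : relCW A) (Y : diffSpace R).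
Variables (f : X -> Y) (f_smooth : smooth f).

Local Notation D := (lower_skel (sub_space A) (skel C)).

(** A homotopy in curried form. Because of the shift in [lower_skel], index [n] refers to $X^{n-1}$,
    and index 0 to $A$. *)
Definition partial_homotopy e n (w : D n -> path_space Y) :=
  [/\ smooth w, forall x, path_tame e (sval (w x)) &
      forall x, sval (w x) (endpoint false) = f (to_total x)].

(** The old homotopy and the extensions over the cells agree along the attaching maps, so the
    pushout property glues them. *)
Lemma partial_homotopy_next e e' n (w : D n -> path_space Y) :
  gathered C -> 0 < e -> e < e' -> e' <= 2^-1 -> partial_homotopy e' w ->
  exists2 w' : D n.+1 -> path_space Y, partial_homotopy e w' &
    forall x, w' (skel_incl x) = w x.
Proof.
move=> gC e0 ee' e'2 [sw tw w0].
have [sc cd _] := to_total_colim C.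
have po := @skel_pushout _ _ _ C n; have [su sv uv up] := po.
have sX : smooth (f \o @to_total _ _ _ C n.+1) by exact: smooth_comp.
pose g l (x : cube n) : Y := f (@to_total _ _ _ C n.+1 (cell_map (existT _ l x))).
have sg l : smooth (g l).
  have si := @smooth_coprod_inj _ (fun _ : cells C n => cube n) l.
  exact: smooth_comp (smooth_comp si sv) sX.
pose k l (z : prod_space (boundary n) I) : Y := sval (w (attach l z.1)) z.2.
have sk l : smooth (k l).
  apply: (iffLR (smooth_path_space (fun x => w (attach l x)))).
  by apply: smooth_comp sw; exact: attach_smooth.
have kg l x : k l (x, endpoint false) = g l (boundary_incl x).
  have := uv (existT _ l x); rewrite /= /coprod_rec /coprod_map /= => E.
  by rewrite /k /g -E w0 /=; congr f; rewrite -cd.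
(* The tameness of the attaching maps may vary with the cell, without a common lower bound; the time
   constants [e] and [e'] are the same for all cells, as a tame glued homotopy requires. *)
have /choice[G HG] : forall l, exists G : prod_space (cube n) I -> Y, [/\ smooth G,
    forall x, path_tame e (fun t => G (x, t)),
    forall x t, G (boundary_incl x, t) = k l (x, t) &
    forall x, G (x, endpoint false) = g l x].
  move=> l; apply: (@cell_homotopy _ n Y (g l) (k l) e e') => //.
    by move=> x; exact: (tw (attach l x)).
  have [b b01 tb] := gC n l; exists b => // j al s s' t sj ss'.
  by rewrite /k /= (tb _ _ _ _ sj ss').
have sG l : smooth (G l) by have [] := HG l.
have tG l x : path_tame e (sval (curry_path (sG l) x)) by have [_ + _ _] := HG l; apply.
pose T := tame_path_space e Y.
pose a x : T := sub_mk (path_tame_le (ltW ee') (tw x) :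
  [set c : path_space Y | path_tame e (sval c)] (w x)).
pose b l x : T := sub_mk (tG l x :
  [set c : path_space Y | path_tame e (sval c)] (curry_path (sG l) x)).
have sa : smooth a by exact: sw.
have sb l : smooth (b l) by exact: (smooth_curry_path (sG l)).
have ab : a \o coprod_rec (@attach _ _ _ C n) =1
          coprod_rec b \o coprod_map (fun=> @boundary_incl R n).
  case=> l x; apply: val_inj; apply: path_space_eq => t /=.
  by have [_ _ -> _] := HG l.
have [w' [[sw' w'u w'v] _]] := up T a (coprod_rec b) sa (smooth_coprod_rec sb) ab.
exists (fun x => sub_val (w' x)); last by move=> x; have /(congr1 (@sub_val _ _ _)) := w'u x.
split=> [|x|].
- exact: smooth_comp sw' (@smooth_sub_val _ _).
- exact: set_mem (valP (w' x)).
(* The initial condition is an equality of smooth maps out of the pushout, checked on the previous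
   skeleton and on the cells. *)
- apply: (pushout_eq po) => //.
  + exact: smooth_comp (smooth_comp sw' (@smooth_sub_val _ _)) (@smooth_eval _ _ _).
  + move=> x; have /(congr1 (@sub_val _ _ _)) /= -> := w'u x.
    by rewrite w0; congr f; rewrite -cd.
  + move=> [l x]; have /(congr1 (@sub_val _ _ _)) /= -> := w'v (existT _ l x).
    by have [_ _ _ +] := HG l; apply.
Qed.

End Cells.

(** * Recursion over the skeleta *)

Section Skeleta.
Variables (X : diffSpace R) (A : set X) (C : relCW A) (Y : diffSpace R).
Variables (f : X -> Y).
Hypotheses (f_smooth : smooth f) (gC : gathered C).
Variables (e0 : R) (w0 : lower_skel (sub_space A) (skel C) 0 -> path_space Y).

Local Notation D := (lower_skel (sub_space A) (skel C)).

(* No common tameness survives passing to the next skeleton, but these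
   decreasing ones stay above [e0 / 2]. *)
Definition tameness (n : nat) : R := e0 / 2 + e0 / 2 ^+ n.+1.

Lemma skeleta_homotopy : 0 < e0 <= 2^-1 -> partial_homotopy f e0 w0 ->
  exists2 w : forall n, D n -> path_space Y,
    (forall n, partial_homotopy f (e0 / 2) (w n)) /\ w 0%N = w0 &
    forall n x, w n.+1 (skel_incl x) = w n x.
Proof.
move=> /andP[e0_gt0 e0_half] hw0.
have tame_gt n : e0 / 2 < tameness n by rewrite ltrDl divr_gt0 // exprn_gt0.
have tame_lt n : tameness n.+1 < tameness n.
  rewrite ltrD2l ltr_pM2l // ltf_pV2 ?posrE ?exprn_gt0 //.
  by rewrite [ltRHS]exprS ltr_pMl ?exprn_gt0 // ltr1n.
have tame0 : tameness 0 = e0 by rewrite /tameness expr1; lra.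
have tame_le n : tameness n <= 2^-1.
  elim: n => [|n IH]; first by rewrite tame0.
  exact: le_trans (ltW (tame_lt n)) IH.
pose S n := {w : D n -> path_space Y | partial_homotopy f (tameness n) w}.
have next n (w : S n) :
    {w' : S n.+1 | forall x, sval w' (skel_incl x) = sval w x}.
  apply: cid; case: w => w hw.
  have pos : 0 < tameness n.+1 by apply: lt_trans (tame_gt _); rewrite divr_gt0.
  have [w' hw' ww'] := partial_homotopy_next f_smooth gC pos (tame_lt n) (tame_le n) hw.
  by exists (exist _ w' hw').
have hw0' : partial_homotopy f (tameness 0) w0 by rewrite tame0.
(* The chosen extensions are iterated as dependent pairs, so that each stage restricts exactly to
   the one before, as the colimit demands. *)
pose s := fix s n : S n :=
  if n is m.+1 then sval (next m (s m)) else exist _ w0 hw0'.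
exists (fun n => sval (s n)).
  split=> // n; have [sw tw st] := svalP (s n); split=> // x.
  exact: path_tame_le (ltW (tame_gt n)) (tw x).
by move=> n; exact: (svalP (next n (s n))).
Qed.

End Skeleta.
End Extension.

(** * Passage to the colimit *)

Theorem lemma5p3 (R : realType) (X : diffSpace R) (A : set X) (C : relCW A)
    (C_gathered : gathered C) (Y : diffSpace R) (f : X -> Y)
    (f_smooth : smooth f)
    (h : prod_space (sub_space A) unit_interval -> Y)
    (h_smooth : smooth h) (h_tame : tame_homotopy h)
    (h_start : forall a : sub_space A, h (a, endpoint false) = f (sub_val a)) :
  exists H : prod_space X unit_interval -> Y,
    [/\ smooth H, tame_homotopy H,
        forall (a : sub_space A) (t : unit_interval), H (sub_val a, t) = h (a, t) &
        forall x : X, H (x, endpoint false) = f x].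
Proof.
have [e0 e0_half h_tame0] := h_tame.
have tc := to_total_colim C; have [sc _ up] := tc.
pose w0 : lower_skel (sub_space A) (skel C) 0 -> path_space Y := curry_path h_smooth.
have hw0 : partial_homotopy f e0 w0.
  split; [exact: smooth_curry_path|by move=> x t al; exact: h_tame0|].
  by move=> a; rewrite to_total0; exact: h_start.
have [w [hw w0E] ww] := skeleta_homotopy f_smooth C_gathered e0_half hw0.
have sw n : smooth (w n) by have [] := hw n.
have tw n x : path_tame (e0 / 2) (sval (w n x)) by have [_ + _] := hw n; apply.
have sf n x : sval (w n x) (endpoint false) = f (to_total x) by have [_ _] := hw n.
(* All stages share the tameness [e0 / 2], so the colimit property applies with a single target
   space. *)
pose a n x : tame_path_space (e0 / 2) Y := sub_mk (tw n x :
  [set c : path_space Y | path_tame (e0 / 2) (sval c)] (w n x)).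
have [||W [[sW Wa] _]] := up (tame_path_space (e0 / 2) Y) a.
- by move=> n; exact: sw.
- by move=> n x; apply: val_inj; exact: ww.
have sWv : smooth (fun x => sub_val (W x)) by exact: smooth_comp sW (@smooth_sub_val _ _ _).
have Wv n x : sub_val (W (@to_total _ _ _ C n x)) = w n x.
  by have /(congr1 (@sub_val _ _ _)) := Wa n x.
exists (fun z => sval (sub_val (W z.1)) z.2); split.
- exact: (iffLR (smooth_path_space (fun x => sub_val (W x)))).
- have /andP[e0_gt0 e02] := e0_half.
  exists (e0 / 2); first by apply/andP; lra.
  by move=> x t b; exact: (set_mem (valP (W x))).
- by move=> x t; rewrite -(to_total0 C) /= Wv w0E.
(* Evaluation at time 0 is smooth, so the initial condition follows from uniqueness for maps out of
   the colimit. *)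
- apply: (seq_colim_eq tc (w := fun x => sval (sub_val (W x)) (endpoint false))) => //.
    exact: smooth_comp sWv (@smooth_eval _ _ _).
  by move=> n x /=; rewrite Wv sf.
Qed.
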